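(* Let $n\ge 3$ be an integer. Then $\Gamma(D_n)$ is a cograph if and only if $n$ is a power of an odd prime.
   Context: For a finite group $G$, the co-maximal subgroup graph $\Gamma(G)$ is the simple undirected graph whose vertices are the non-trivial proper subgroups of $G$, two distinct vertices $H,K$ being adjacent if and only if $HK=G$, where $HK=\{hk: h\in H, k\in K\}$. $D_n=\langle r,s: r^n=s^2=1,\ srs^{-1}=r^{-1}\rangle$ is the dihedral group of order $2n$. A graph is a cograph if it has no induced subgraph isomorphic to $P_4$, the path on $4$ vertices. *)

(* Defs.v *)
From mathcomp Require Import all_boot all_fingroup all_solvable.

Set Implicit Arguments.
Unset Strict Implicit.
Unset Printing Implicit Defensive.

Local Open Scope group_scope.

Record sgraph := SGraph {
  vertex : finType;
  adj : rel vertex;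
  adj_sym : symmetric adj;
  adj_irr : irreflexive adj }.

Definition has_induced (F X : sgraph) : Prop :=
  exists f : vertex F -> vertex X,
    injective f /\ forall u v, adj (f u) (f v) = adj u v.

Definition path4_adj : rel 'I_4 :=
  fun i j => (j == i.+1 :> nat) || (i == j.+1 :> nat).

Lemma path4_sym : symmetric path4_adj.
Proof. by move=> i j; rewrite /path4_adj orbC. Qed.

Lemma path4_irr : irreflexive path4_adj.
Proof. by move=> i; rewrite /path4_adj orbb ltn_eqF. Qed.

Definition path4 : sgraph := SGraph path4_sym path4_irr.

Definition cograph (X : sgraph) : Prop := ~ has_induced path4 X.

Section Comaximal.

Variables (gT : finGroupType) (G : {group gT}).

Definition nontrivial_proper (H : {group gT}) : bool :=
  (H :!=: 1) && (H \proper G).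

Definition comaximal_vertex : finType :=
  {H : {group gT} | nontrivial_proper H}.

Definition comaximal_adj : rel comaximal_vertex :=
  fun H K => (H != K) && (val H * val K == G :> {set gT}).

Lemma comaximal_sym : symmetric comaximal_adj.
Proof.
suff imp H K : comaximal_adj H K -> comaximal_adj K H.
  by move=> H K; apply/idP/idP; apply: imp.
case/andP=> neHK /eqP defG; rewrite /comaximal_adj eq_sym neHK /=.
by rewrite -[_ * _]invgK invMg !invGid defG invGid.
Qed.

Lemma comaximal_irr : irreflexive comaximal_adj.
Proof. by move=> H; rewrite /comaximal_adj eqxx. Qed.

Definition comaximal_graph : sgraph := SGraph comaximal_sym comaximal_irr.

End Comaximal.

(* Main.v *)
Require Import Defs.
From mathcomp Require Import all_boot all_fingroup all_solvable.

(** Let R = <r> be the rotation subgroup of D_n: it is cyclic of index 2.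

If n is a power of an odd prime p and HK = D_n, then H or K is R
([comaximal_cyclic_index2]): since R is a cyclic p-group, the subgroups
H :&: R and K :&: R are comparable, say H :&: R <= K :&: R; then
|H : H :&: K| <= |H : H :&: R| <= 2, so K has index at most 2, and a proper such
K has order |R| = p ^ k and lies in the normal Sylow p-subgroup R.  Every edge
of the graph thus contains R, whereas a path on 4 vertices has two disjoint
edges.

Otherwise an induced path H1 - H2 - H3 - H4 is exhibited, such that H1 <= H3
and H4 <= H2, so that two of the three non-edges hold because a product of
nested proper subgroups is not the whole group ([comaximal_path4]).
- If n is even, take <s> - <r^2, rs> - <r^2, s> - <rs>.  The middle groups have
  index 2, so their product with any subgroup they do not contain is D_n
  ([dihedral_even_path4]).
- If R = A * B with A and B nontrivial and A :&: B = 1, take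
  A - <B, s> - <A, s> - B ([dihedral_coprime_path4]).  When n is odd but not a
  prime power, A and B can be the p-part and the p'-part of R for a prime p
  dividing n. *)

Set Implicit Arguments.
Unset Strict Implicit.
Unset Printing Implicit Defensive.

Section ComaximalDihedral.

Local Open Scope group_scope.

(** * Induced paths in a co-maximal subgroup graph *)

(** Injectivity is automatic because distinct vertices of the path on 4
vertices have distinct neighbourhoods. *)
Lemma path4_hom_inj (X : sgraph) (f : 'I_4 -> vertex X) :
  (forall u v, adj (f u) (f v) = path4_adj u v) -> injective f.
Proof.
move=> fP u v fuv.
have: [forall w, path4_adj u w == path4_adj v w].
  by apply/forallP=> w; rewrite -!fP fuv.
move=> /forallP h; apply/val_inj.
have := (h (inord 0), h (inord 1), h (inord 2), h (inord 3)).
rewrite /path4_adj !inordK //; clear.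
by case: u => [[|[|[|[]]]] //= ?]; case: v => [[|[|[|[]]]] //= ?]; case=> [[[? ?] ?] ?].
Qed.

Lemma mulG_factC (gT : finGroupType) (G H K : {group gT}) :
  H * K = G -> K * H = G.
Proof. by move=> defG; rewrite -[K * H]invgK invMg !invGid defG invGid. Qed.

(** Distinctness of the endpoints is automatic, as H * H = H is proper. *)
Lemma comaximal_adjE (gT : finGroupType) (G : {group gT})
    (H K : comaximal_vertex G) :
  comaximal_adj H K = (val H * val K == G :> {set gT}).
Proof.
rewrite /comaximal_adj; case: eqVneq => //= ->.
by rewrite mulGid; have /andP[_ /proper_neq/negPf->] := valP K.
Qed.

Lemma comaximal_path4 (gT : finGroupType) (G H1 H2 H3 H4 : {group gT}) :
    all (nontrivial_proper G) [:: H1; H2; H3; H4] ->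
    H1 \subset H3 -> H4 \subset H2 ->
    H1 * H2 = G -> H2 * H3 = G -> H3 * H4 = G -> H1 * H4 != G ->
  has_induced path4 (comaximal_graph G).
Proof.
move=> /= /and5P[v1 v2 v3 v4 _] s13 s42 e12 e23 e34 n14.
pose f (i : 'I_4) : vertex (comaximal_graph G) :=
  tnth [tuple exist _ H1 v1; exist _ H2 v2; exist _ H3 v3; exist _ H4 v4] i.
have idN (H : {group gT}) : nontrivial_proper G H -> H * H != G.
  by case/andP=> _ /proper_neq; rewrite mulGid.
have mulC (H K : {group gT}) : (K * H == G) = (H * K == G).
  by apply/eqP/eqP; apply: mulG_factC.
have n13: H1 * H3 != G by rewrite mulSGid // (proper_neq (proj2 (andP v3))).
have n24: H2 * H4 != G by rewrite mulGSid // (proper_neq (proj2 (andP v2))).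
have fP u v : adj (f u) (f v) = path4_adj u v.
  rewrite /= comaximal_adjE /f /path4_adj !(tnth_nth (exist _ H1 v1)).
  case: u => [[|[|[|[]]]] //= ?]; case: v => [[|[|[|[]]]] //= ?];
    by [apply/eqP | apply/eqP/mulG_factC | apply/negbTE; rewrite ?idN // mulC].
by exists f; split=> //; apply: path4_hom_inj; apply: fP.
Qed.

(** * Products involving a subgroup of index 2 *)

(** The subgroup generated by a subgroup A of R and an involution outside R
that normalises A. *)
Lemma join_involution (gT : finGroupType) (R A : {group gT}) (t : gT) :
    A \subset R -> t \in 'N(A) -> t \notin R -> #[t] = 2 ->
  [/\ A <*> <[t]> = A * <[t]>, #|A <*> <[t]>| = (#|A|).*2
    & (A <*> <[t]>) :&: R = A].
Proof.
move=> sAR nAt Rt ot.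
have tiR: <[t]> :&: R = 1 by rewrite prime_TIg -?orderE ?ot // cycle_subG.
have defM: A <*> <[t]> = A * <[t]> by rewrite norm_joinEr ?cycle_subG.
split=> //; rewrite defM; last by rewrite -group_modl // tiR mulg1.
rewrite TI_cardMg -?orderE ?ot ?muln2 //.
by apply/trivgP; rewrite /= setIC -tiR setIS.
Qed.

(** When R is a cyclic p-group of index 2 with p odd, R is an endpoint of every
edge of the co-maximal subgroup graph of G. *)
Lemma comaximal_cyclic_index2 (gT : finGroupType) (G R H K : {group gT}) p :
    prime p -> odd p -> p.-group R -> cyclic R -> R \subset G ->
    #|G : R| = 2 -> H \proper G -> K \proper G -> H * K = G ->
  H :=: R \/ K :=: R.
Proof.
move=> pr_p odd_p pR cR sRG iR.
have nRG: R <| G by apply: index2_normal.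
have oG: #|G| = (#|R|).*2 by rewrite -(Lagrange sRG) iR muln2.
(* Subgroups of a cyclic p-group are linearly ordered by inclusion. *)
wlog sHK: H K / H :&: R \subset K :&: R.
  move=> IH prH prK defG; have [oH oK]: (p.-nat #|H :&: R| /\ p.-nat #|K :&: R|)%N.
    by split; apply: pgroupS pR; apply: subsetIr.
  have [[a oA] [b oB]] := (p_natP oH, p_natP oK).
  have cmp: (H :&: R \subset K :&: R) || (K :&: R \subset H :&: R).
    rewrite -(cardSg_cyclic cR (subsetIr H R) (subsetIr K R)).
    rewrite -(cardSg_cyclic cR (subsetIr K R) (subsetIr H R)) oA oB.
    by have [le|/ltnW le] := leqP a b; rewrite (dvdn_exp2l p le) ?orbT.
  case/orP: cmp => [/IH|/IH h]; first by apply.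
  by have [] := h prK prH (mulG_factC defG); [right|left].
move=> prH prK defG; right.
have leH: #|H| <= (#|H :&: R|).*2.
  have := mul_cardG H R.
  have: #|H * R| <= #|G| by rewrite subset_leq_card // mul_subG // proper_sub.
  have := cardG_gt0 R; rewrite oG => R0 leHR eHR.
  rewrite -(leq_pmul2r R0) eHR -doubleMl doubleMr [leqRHS]mulnC.
  by rewrite leq_mul.
(* |G| |H :&: K| = |H| |K| <= 2 |H :&: R| |K| and H :&: R <= H :&: K. *)
have iK: #|G : K| = 2.
  have sKG := proper_sub prK; apply/eqP; rewrite eqn_leq indexg_gt1.
  rewrite proper_subn // andbT -(leq_pmul2l (cardG_gt0 K)) Lagrange //.
  rewrite -(leq_pmul2r (cardG_gt0 (H :&: K))) -{1}defG -mul_cardG mulnC.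
  rewrite -mulnA leq_pmul2l ?cardG_gt0 // mul2n (leq_trans leH) // leq_double.
  by rewrite subset_leq_card // subsetI subsetIl (subset_trans sHK) ?subsetIl.
have oK: #|K| = #|R|.
  by apply: double_inj; rewrite -oG -(Lagrange (proper_sub prK)) iK muln2.
have hallR: p.-Sylow(G) R.
  rewrite pHallE sRG /= -(card_Hall (H := R)) // /pHall sRG pR iR /=.
  by rewrite p'natE // dvdn_prime2 //; apply: contraL odd_p => /eqP->.
apply/eqP; rewrite eqEcard oK leqnn andbT (sub_normal_Hall hallR) ?proper_sub //.
by rewrite /pgroup oK.
Qed.

Lemma mulg_index2 (gT : finGroupType) (G H M : {group gT}) :
    M \subset G -> #|G : M| = 2 -> H \subset G -> ~~ (H \subset M) ->
  H * M = G.
Proof.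
move=> sMG iM sHG nsHM; apply: mulG_factC.
apply: mulg_normal_maximal nsHM => //; first exact: index2_normal.
by apply: p_index_maximal; rewrite ?iM.
Qed.

(** * Dihedral groups *)

Lemma dihedral_gens (gT : finGroupType) (G : {group gT}) n :
    1 < n -> G \isog [set: 'D_(n.*2)] -> exists x s : gT,
  [/\ #[x] = n, #[s] = 2, s \notin <[x]>, x ^ s = x^-1 & <[x]> * <[s]> = G].
Proof.
move=> n1 isoG.
have cardG: #|G| = n.*2 by rewrite (card_isog isoG) card_dihedral.
have := isog_hom isoG; rewrite (Grp_dihedral n1).
case/existsP=> -[x y] /eqP[defG xn y2 xy]; exists x, y.
have nxy: <[y]> \subset 'N(<[x]>).
  by rewrite cycle_subG; apply/normP; rewrite -cycleJ xy cycleV.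
have {}defG: <[x]> * <[y]> = G by rewrite -norm_joinEr.
have oG: #|<[x]> * <[y]>| = n.*2 by rewrite defG.
have lex: #[x] <= n by rewrite dvdn_leq ?order_dvdn ?xn // ltnW.
have ley: #[y] <= 2 by rewrite dvdn_leq ?order_dvdn ?y2.
(* The orders of x and y divide n and 2, and |G| = 2n forces equality. *)
have leG: n.*2 <= #[x] * #[y].
  by rewrite -[leqLHS]oG !orderE mul_cardG leq_pmulr ?cardG_gt0.
have ex: #[x] = n.
  apply/eqP; rewrite eqn_leq lex -leq_double (leq_trans leG) //.
  by rewrite -muln2 leq_mul.
have ey: #[y] = 2.
  apply/eqP; rewrite eqn_leq ley -(leq_pmul2l (ltnW n1)) muln2.
  by rewrite -[X in _ <= (X * _)%N]ex.
split=> //; apply/negP=> xy'.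
have: #|<[x]> * <[y]>| = n by rewrite mulGSid ?cycle_subG // -orderE.
by move/eqP; rewrite oG -addnn -[X in _ == X]addn0 eqn_add2l -leqn0 leqNgt ltnW.
Qed.

Section Dihedral.

(** G is a dihedral group of order 2n, with rotation x and reflection s. *)
Variables (gT : finGroupType) (G : {group gT}) (x s : gT) (n : nat).
Hypotheses (n_gt2 : 2 < n) (ox : #[x] = n) (os : #[s] = 2).
Hypotheses (Rs : s \notin <[x]>) (xs : x ^ s = x^-1) (defG : <[x]> * <[s]> = G).

Local Notation R := <[x]>%G.
Local Notation T := <[s]>%G.

Let oG : #|G| = n.*2.
Proof.
rewrite -defG TI_cardMg -?orderE ?ox ?os ?muln2 // setIC.
by rewrite prime_TIg -?orderE ?os // cycle_subG.
Qed.

Let sRG : R \subset G. Proof. by rewrite -defG mulG_subl. Qed.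
Let sTG : T \subset G. Proof. by rewrite -defG mulG_subr. Qed.

Lemma dihedral_rot_index : #|G : R| = 2.
Proof. by rewrite -divgS // oG -orderE ox -muln2 mulKn // ltnW // ltnW. Qed.

Lemma dihedral_rot_subnormal (A : {group gT}) : A \subset R -> A <| G.
Proof.
move=> sAR; apply: char_normal_trans (index2_normal sRG dihedral_rot_index).
exact: cycle_subgroup_char.
Qed.

(** The path is <s> - <x^2, xs> - <x^2, s> - <xs>; evenness of n makes <x^2> a
proper subgroup of R, so that xs lies outside <x^2, s> and s outside
<x^2, xs>. *)
Lemma dihedral_even_path4 : ~~ odd n -> has_induced path4 (comaximal_graph G).
Proof.
move=> n_even; pose C := <[x ^+ 2]>%G; pose t := x * s; pose T' := <[t]>%G.
have Gx : x \in G by rewrite -cycle_subG.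
have Gs : s \in G by rewrite -cycle_subG.
have Rt : t \notin R by rewrite groupMl ?cycle_id.
have ot : #[t] = 2.
  apply: nt_prime_order => //; last by apply: contraNneq Rt => ->; rewrite group1.
  have ss : s^-1 = s by apply/eqP; rewrite eq_invg_mul -[s * s]/(s ^+ 2) -order_dvdn os.
  by rewrite expgS expg1 /t -mulgA -{1}ss -/(x ^ s) xs mulgV.
have sCR : C \subset R by rewrite cycle_subG mem_cycle.
have oC : #|C| = n./2 by rewrite -orderE orderXdiv ox ?dvdn2 // divn2.
have nC u : u \in G -> u \in 'N(C).
  by have /andP[_ /subsetP] := dihedral_rot_subnormal sCR; apply.
have [_ oM1 cM1] := join_involution sCR (nC s Gs) Rs os.
have [_ oM2 cM2] := join_involution sCR (nC t (groupM Gx Gs)) Rt ot.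
set M1 := (C <*> T)%G in oM1 cM1; set M2 := (C <*> T')%G in oM2 cM2.
have half : (n./2).*2 = n by rewrite even_halfK.
have Cx : x \notin C.
  apply/negP; rewrite -cycle_subG => /subset_leq_card.
  rewrite oC -orderE ox -{1}half -addnn -{3}[n./2]addn0 leq_add2l leqNgt.
  by rewrite half_gt0 ltnW.
have sCG := subset_trans sCR sRG.
have sT'G : T' \subset G by rewrite cycle_subG groupM.
have [sM1 sM2] : M1 \subset G /\ M2 \subset G.
  by split; rewrite join_subG sCG.
have [iM1 iM2] : #|G : M1| = 2 /\ #|G : M2| = 2.
  have n0 : 0 < n by rewrite ltnW // ltnW.
  by split; rewrite -divgS // oG ?oM1 ?oM2 oC half -muln2 mulKn.
have M1s : s \in M1 by rewrite mem_gen // inE cycle_id orbT.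
have M2t : t \in M2 by rewrite mem_gen // inE cycle_id orbT.
(* If M1 or M2 contained both reflections s and t, it would contain x, but it
   meets R in C only. *)
have ns1 : ~~ (T' \subset M1).
  rewrite cycle_subG groupMr //; apply: contra Cx => M1x.
  by rewrite -[C : {set _}]cM1 inE M1x cycle_id.
have ns2 : ~~ (T \subset M2).
  rewrite cycle_subG; apply: contra Cx => M2s.
  by rewrite -[C : {set _}]cM2 inE cycle_id andbT -(groupMr _ M2s).
have ntT u : #[u] = 2 -> u \in G -> nontrivial_proper G <[u]>%G.
  move=> ou Gu; rewrite /nontrivial_proper properEcard cycle_subG Gu /= -orderE.
  by rewrite trivg_card1 -orderE ou oG -[2]/(1.*2) ltn_double ltnW.
have ntM (M : {group gT}) u : M \subset G -> #|G : M| = 2 -> u \in M ->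
    #[u] = 2 -> nontrivial_proper G M.
  move=> sMG iM Mu ou; rewrite /nontrivial_proper properEneq sMG andbT.
  apply/andP; split; last by apply: contra_eqN iM => /eqP->; rewrite indexgg.
  apply: contraL Mu => /eqP->; apply/negP => /set1P u1.
  by rewrite u1 order1 in ou.
apply: (@comaximal_path4 _ G T M2 M1 T').
- by rewrite /= !ntT ?groupM // (ntM M2 t) // (ntM M1 s).
- by rewrite cycle_subG.
- by rewrite cycle_subG.
- exact: mulg_index2.
- apply: mulg_index2 => //; apply: contra ns1; apply: subset_trans.
  by rewrite cycle_subG.
- by apply: mulG_factC; apply: mulg_index2.
(* |<s> * <t>| <= 4 < 2n. *)
apply/eqP=> defG'; have := mul_cardG T T'.
rewrite defG' -!orderE os ot oG => /eqP; apply/negP.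
rewrite neq_ltn; apply/orP; left; apply: leq_trans (leq_pmulr _ (cardG_gt0 _)).
by rewrite -[(2 * 2)%N]/(2.*2) ltn_double.
Qed.

(** The path is A - <B, s> - <A, s> - B. *)
Lemma dihedral_coprime_path4 (A B : {group gT}) :
    A :!=: 1 -> B :!=: 1 -> A :&: B = 1 -> A * B = R ->
  has_induced path4 (comaximal_graph G).
Proof.
move=> ntA ntB tiAB defR.
have aux (C D : {group gT}) : C :!=: 1 -> D :!=: 1 -> C :&: D = 1 -> C * D = R ->
    [/\ nontrivial_proper G C, nontrivial_proper G (D <*> T)%G
      & C * (D <*> T) = G].
  move=> ntC ntD tiCD defCD.
  have [sCR sDR] : C \subset R /\ D \subset R.
    by rewrite -defCD mulG_subl mulG_subr.
  have sDG := subset_trans sDR sRG.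
  have prR : R \proper G.
    by rewrite properE sRG -indexg_gt1 dihedral_rot_index.
  have nDs : s \in 'N(D).
    have /andP[_ /subsetP-> //] := dihedral_rot_subnormal sDR.
    by rewrite -cycle_subG.
  have [defM _ capM] := join_involution sDR nDs Rs os.
  split; last by rewrite defM mulgA defCD.
    by rewrite /nontrivial_proper ntC (sub_proper_trans sCR).
  rewrite /nontrivial_proper properEneq join_subG sDG sTG !andbT.
  apply/andP; split.
    by apply: contra ntD => /eqP M1; rewrite -subG1 -M1 joing_subl.
  (* <D, s> meets R in D, so it is G only if D = R, whence C = 1. *)
  apply: contra ntC => /eqP defMG; rewrite -subG1 -tiCD subsetI subxx.
  by rewrite -capM defMG subsetI sCR (subset_trans sCR).
have [vA vMB eA] := aux _ _ ntA ntB tiAB defR.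
have [vB vMA eB] : [/\ _, _ & _] :=
  aux B A ntB ntA (etrans (setIC _ _) tiAB) (mulG_factC defR).
have sMBG : B <*> T \subset G by case/andP: vMB => _ /proper_sub.
have sMAG : A <*> T \subset G by case/andP: vMA => _ /proper_sub.
apply: (@comaximal_path4 _ G A (B <*> T) (A <*> T) B) => //.
- by rewrite /= vA vMB vMA vB.
- exact: joing_subl.
- exact: joing_subl.
- apply: mulG_factC; apply/eqP; rewrite eqEsubset mul_subG //=.
  by rewrite -{1}eA mulSg ?joing_subl.
- exact: mulG_factC.
rewrite defR; apply: contraNneq Rs => ->.
by rewrite -cycle_subG.
Qed.

Lemma dihedral_ppower_or_path4 :
  (exists p k : nat, [/\ prime p, odd p, 0 < k & n = (p ^ k)%N])
  \/ has_induced path4 (comaximal_graph G).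
Proof.
have [n_odd|] := boolP (odd n); last by right; apply: dihedral_even_path4.
have n0 : 0 < n by rewrite ltnW // ltnW.
pose p := pdiv n; have pr_p : prime p by rewrite pdiv_prime // ltnW.
have pn : p %| n := pdiv_dvd n.
have lp : 0 < logn p n by rewrite logn_gt0 mem_primes pr_p n0.
have [n1|n_p'] := eqVneq (n`_p^')%N 1%N.
  left; exists p, (logn p n); split=> //; first exact: dvdn_odd pn n_odd.
  by rewrite -p_part -[LHS](partnC p n0) n1 muln1.
have nilR : nilpotent R by apply: abelian_nil; apply: cycle_abelian.
have [_ defR _ tiR] := dprodP (nilpotent_pcoreC p nilR).
right; apply: dihedral_coprime_path4 tiR defR.
  rewrite trivg_card1 (card_Hall (nilpotent_pcore_Hall p nilR)).
  by rewrite -orderE ox p_part -(expn0 p) eqn_exp2l ?prime_gt1 // -lt0n.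
rewrite trivg_card1 (card_Hall (nilpotent_pcore_Hall p^' nilR)).
by rewrite -orderE ox.
Qed.

Lemma dihedral_ppower_cograph p k :
  prime p -> odd p -> n = (p ^ k)%N -> cograph (comaximal_graph G).
Proof.
move=> pr_p odd_p def_n [f [f_inj fP]].
(* R is an endpoint of each of the disjoint edges 0 - 1 and 2 - 3. *)
have edge i j : path4_adj i j -> val (val (f i)) = R \/ val (val (f j)) = R.
  rewrite -[path4_adj i j]/(@adj path4 i j) -fP /= comaximal_adjE => /eqP.
  have /andP[_ pri] := valP (f i); have /andP[_ prj] := valP (f j).
  apply: (comaximal_cyclic_index2 pr_p odd_p) pri prj => //.
  - by rewrite /pgroup -orderE ox def_n pnatX pnat_id.
  - exact: cycle_cyclic.
  - exact: dihedral_rot_index.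
have inj i j : val (val (f i)) = R -> val (val (f j)) = R -> i = j.
  by move=> fi fj; apply/f_inj/val_inj/val_inj; rewrite fi.
pose o m := inord m : 'I_4.
have e01 : path4_adj (o 0%N) (o 1%N) by rewrite /path4_adj !inordK.
have e23 : path4_adj (o 2%N) (o 3%N) by rewrite /path4_adj !inordK.
by case: (edge _ _ e01) => /inj h1; case: (edge _ _ e23) => /h1 /(congr1 val);
  rewrite /= !inordK.
Qed.

End Dihedral.

End ComaximalDihedral.

(* 'D_m is the dihedral group of order m (Grp_dihedral), so D_n is 'D_(n.*2). *)
Theorem theorem5p1 (n : nat) (hn : 3 <= n) :
  cograph (comaximal_graph [set: 'D_(n.*2)]%G) <->
  exists p k : nat, [/\ prime p, odd p, 0 < k & n = p ^ k].
Proof.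
have [x [s [ox os Rs xs defG]]] := dihedral_gens (ltnW hn) (isog_refl _).
split=> [cogr | [p [k [pr_p odd_p _ def_n]]]].
  by case: (dihedral_ppower_or_path4 hn ox os Rs xs defG).
exact: dihedral_ppower_cograph defG _ _ pr_p odd_p def_n.
Qed.
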